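(* Let $p$ be a prime, let $q$ be an odd prime that divides $p-1$, and let $r$ be a divisor of $p-1$ that is coprime to $q$. Then there exists a finite solvable group $G$ with $\mathrm{dl}(G)=4$, Fitting height $3$, and $$\mathrm{cd}(G)=\Big\{1,\ q,\ \Big(\tfrac{p^q-1}{p-1}\Big)_{q'}(p-1)_q\,q\,r,\ p^q\Big(\tfrac{p^q-1}{p-1}\Big)_{q'}(p-1)_q\,q\Big\}.$$
   Context: $\mathrm{cd}(G)$ is the set of degrees of irreducible complex characters of $G$, and $\mathrm{dl}(G)$ is the derived length of $G$. For a positive integer $N$ and a prime $q$, $N_q$ denotes the largest power of $q$ dividing $N$, and $N_{q'}=N/N_q$. *)

(* Defs.v *)
From HB Require Import structures.
From mathcomp Require Import all_boot all_order all_algebra all_fingroup all_solvable all_field all_character.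
Set Implicit Arguments. Unset Strict Implicit. Unset Printing Implicit Defensive.
Import GroupScope.

Open Scope group_scope.

Definition derived_length_is (gT : finGroupType) (G : {group gT}) (n : nat) : Prop :=
  G^`(n) = 1 /\ forall m, (m < n)%N -> G^`(m) != 1.

Fixpoint fitting_series (gT : finGroupType) (G : {group gT}) (n : nat) : {set gT} :=
  match n with
  | 0 => 1
  | n'.+1 => coset (fitting_series G n') @*^-1 'F(G / fitting_series G n')
  end.

Definition fitting_height_is (gT : finGroupType) (G : {group gT}) (n : nat) : Prop :=
  fitting_series G n = G /\ forall m, (m < n)%N -> fitting_series G m != G.

Definition cd (gT : finGroupType) (G : {group gT}) : seq algC :=
  [seq ('chi[G]_i 1%g)%R | i <- enum (Iirr G)].

(* Main.v *)
Require Import Defs.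
From HB Require Import structures.
From mathcomp Require Import all_boot all_order all_algebra all_fingroup all_solvable all_field all_character.
From mathcomp Require Import ring.

(** The number n = A q (p-1)_q r divides p^q - 1, so let c have order n in the
    multiplicative group of F = GF(p^q), and let sigma be the Frobenius map.  As q
    divides n and p = 1 (mod q), the semilinear maps c^k sigma^k (k mod n) form a group H
    of order n, which acts semiregularly on the nonzero vectors of F: (p-1)-th powers
    have order dividing (p^q-1)/(p-1) = A q, so if c^k sigma^k fixes a nonzero x then
    c^(k A q) = 1, hence q | k, sigma^k = 1 and c^k = 1.

    Let H act on the Heisenberg group P over F, of order p^(3q), with weights 1 and j on
    the two coordinates of P / Z(P), and thus j + 1 on Z(P).  Choosing j prime to n with
    r | j + 1 and j + 1 prime to n / r makes H semiregular on P / Z(P), while the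
    subgroup of order r of H centralizes Z(P) and the quotient acts semiregularly.  The
    group is G = P : H.

    If lambda is a linear character of a normal subgroup N and I_G(lambda) / N is cyclic,
    then all irreducible characters of G over lambda have degree |G : I_G(lambda)|.  Characters with P in the kernel come from the abelian
    subgroup of index q of H; those with only Z(P) in the kernel are induced from P; for
    the others, N is the abelian group of order p^(2q) with a = 0, and lambda can be
    conjugated so as to be trivial on the b coordinate, whence I_G(lambda) = N : C_r. *)

(** * Characters over linear characters of normal subgroups *)

Section CyclicInertiaQuotient.
Set Implicit Arguments.
Unset Strict Implicit.
Unset Printing Implicit Defensive.
Import GroupScope Order.TTheory GRing.Theory Num.Theory.
Local Open Scope group_scope.

(** By the Clifford correspondence, chi_k is induced from some chi_s of the inertia group T lying
    over chi_i. As chi_s restricts to a multiple of the linear chi_i, N lies in Z(chi_s), so T /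
    Z(chi_s) is cyclic. Hence T / ker chi_s is abelian and chi_s is linear. *)
Lemma irr1_cyclic_inertia_quotient (gT : finGroupType) (G N : {group gT})
    (i : Iirr N) (k : Iirr G) :
    N <| G -> ('chi_i)%R \is a linear_char -> cyclic ('I_G[('chi_i)%R] / N) ->
    i \in irr_constt ('Res[N] 'chi_k)%R ->
  ('chi_k)%R 1%g = (#|G : 'I_G[('chi_i)%R]|%:R)%R.
Proof.
move=> nsNG lin_i cycT ik; pose T := 'I_G[('chi_i)%R]%G.
have [irrI _ BIm _ _] := constt_Inertia_bijection i nsNG.
have: k \in irr_constt ('Ind[G] 'chi_i)%R by rewrite constt_Ind_Res.
rewrite -BIm => /imsetP[s sIT ->].
have sTG : T \subset G by apply: subsetIl.
rewrite cfIirrE ?irrI // cfInd1 //.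
suff lin_s : ('chi_s)%R \is a linear_char by rewrite (lin_char1 lin_s) mulr1.
have nsNT : N <| T by apply: normal_Inertia; apply: normal_sub.
have sNT := normal_sub nsNT.
have is_ : i \in irr_constt ('Res[N] 'chi_s)%R by rewrite -constt_Ind_Res.
have DsN := Clifford_Res_sum_cfclass nsNT is_.
rewrite cfclass_invariant ?subsetIr ?big_seq1 // in DsN.
have sNZ : N \subset 'Z(('chi_s)%R)%CF.
  apply/subsetP=> x Nx; have Tx := subsetP sNT x Nx.
  have := char1_ge0 (cfRes_char N (irr_char s)).
  rewrite irr_cfcenterE // -(cfResE _ sNT Nx) -(cfRes1 N ('chi_s)%R) DsN !cfunE normrM.
  rewrite (normC_lin_char lin_i) // (lin_char1 lin_i) !mulr1.
  by move/ger0_norm->.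
rewrite lin_irr_der1.
have nsZ := cfcenter_normal ('chi_s)%R; have nsK := cfker_normal ('chi_s)%R.
suff abTK : abelian (T / cfker ('chi_s)%R) by rewrite der1_min // normal_norm.
apply: (@cyclic_factor_abelian _ ('Z(('chi_s)%R)%CF / cfker ('chi_s)%R)).
  exact: cfcenter_subset_center.
rewrite (isog_cyclic (third_isog (normal_sub (cfker_center_normal _)) nsK nsZ)).
have [f Df] := homgP (homg_quotientS (normal_norm nsNT) (normal_norm nsZ) sNZ).
by have := morphim_cyclic f cycT; rewrite Df.
Qed.

(** This lemma and the next two express normality and commutators by identities between products, so
    that inverses need not be computed in coordinates. *)
Lemma normal_swap (gT : finGroupType) (N : {group gT}) :
  (forall g x, x \in N -> exists2 y, y \in N & g * x = y * g) -> N <| setT.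
Proof.
move=> swap; rewrite /normal subsetT /=; apply/subsetP=> g _.
rewrite -groupV inE; apply/subsetP=> _ /imsetP[x Nx ->].
by have [y Ny gx] := swap g x Nx; rewrite conjgE invgK mulgA gx mulgK.
Qed.

Lemma swap_mem_commg (gT : finGroupType) (H K : {group gT}) g h w :
  g \in H -> h \in K -> g * h = w * (h * g) -> w \in [~: H, K].
Proof.
move=> Hg Kh gh; have ->: w = [~ g^-1, h^-1].
  by rewrite commgEl conjgE !invgK mulgA mulgA gh !mulgA !mulgK.
by rewrite mem_commg ?groupV.
Qed.

Lemma commg_sub_swap (gT : finGroupType) (H K N : {group gT}) :
  (forall g h w, g \in H -> h \in K -> g * h = w * (h * g) -> w \in N) ->
  [~: H, K] \subset N.
Proof.
move=> swap; rewrite gen_subG; apply/subsetP=> _ /imset2P[g h Hg Kh ->].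
apply: (swap g^-1 h^-1); rewrite ?groupV //.
by rewrite commgEl conjgE !mulgA !mulgK.
Qed.

Lemma preim_Fitting1 (gT : finGroupType) (G : {group gT}) :
  coset 1 @*^-1 'F(G / 1) = 'F(G).
Proof.
have -> : 'F(G / 1) = 'F(G) / 1.
  by rewrite [RHS]injm_Fitting ?ker_coset ?norms1.
by rewrite quotientGK // normal1.
Qed.

Lemma constt_Res_cfker (gT : finGroupType) (G H : {group gT}) (S : {set gT})
    (k : Iirr G) :
    H \subset G -> S \subset H -> ~~ (S \subset cfker ('chi_k)%R) ->
  exists2 i, i \in irr_constt ('Res[H] 'chi_k)%R & ~~ (S \subset cfker ('chi_i)%R).
Proof.
move=> sHG sSH notSk; apply/exists_inP; rewrite -[X in is_true X]negbK.
rewrite negb_exists_in; apply: contra notSk => /forall_inP Sk.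
suff: S \subset cfker ('Res[H] 'chi_k)%R.
  by rewrite cfker_Res ?irr_char // subsetI => /andP[].
rewrite cfkerE ?cfRes_char ?irr_char // subsetI sSH.
by apply/bigcapsP=> i /Sk; rewrite negbK.
Qed.

(** M is the intersection of the kernels of the irreducible characters that contain it in their
    kernel. This is how each degree is shown to occur. *)
Lemma irr_cfker_separates (gT : finGroupType) (G M : {group gT}) (S : {set gT}) :
    M <| G -> ~~ (S \subset M) ->
  exists2 k : Iirr G, M \subset cfker ('chi_k)%R & ~~ (S \subset cfker ('chi_k)%R).
Proof.
move=> nsMG notSM; apply/exists_inP; rewrite -[X in is_true X]negbK.
rewrite negb_exists_in; apply: contra notSM => /forall_inP Sk.
rewrite -(cap_cfker_normal nsMG); apply/bigcapsP=> k /Sk; by rewrite negbK.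
Qed.

Lemma commg_inertia_cfker (gT : finGroupType) (N L : {group gT}) (phi : 'CF(N)) :
  phi \is a linear_char -> L \subset 'I[phi] -> [~: N, L] \subset cfker phi.
Proof.
move=> lin_phi IL; rewrite gen_subG; apply/subsetP=> _ /imset2P[x g Nx Lg ->].
have Ig := subsetP IL g Lg; have nNg := subsetP (norm_inertia phi) g Ig.
have Nxg : x ^ g \in N by rewrite memJ_norm.
suffices: x^-1 * x ^ g \in cfker phi by rewrite commgEl.
rewrite cfkerEchar ?lin_charW // inE groupM ?groupV //=.
rewrite lin_charM ?groupV // lin_charV // (inertia_valJ _ Ig).
by rewrite mulVf ?lin_char_neq0 // lin_char1.
Qed.
End CyclicInertiaQuotient.

(** * The group P : H *)

(* With A = ((p^q - 1)/(p - 1))_{q'}, u = (p - 1)_q and r as in the theorem, c is a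
   generator of the subgroup of order A q u r of the multiplicative group of F. *)
Record semilinear_datum := SemilinearDatum {
  dat_F : finFieldType; dat_c : dat_F;
  dat_p : nat; dat_q : nat; dat_A : nat; dat_u : nat; dat_r : nat; dat_j : nat;
  dat_n := (dat_A * dat_q * dat_u * dat_r)%N;
  dat_p_prime : prime dat_p;
  dat_q_prime : prime dat_q;
  dat_card : #|dat_F| = (dat_p ^ dat_q)%N;
  dat_prim : (dat_n.-primitive_root dat_c)%R;
  dat_q_dvd : dat_q %| dat_p.-1;
  dat_q_dvd_u : dat_q %| dat_u;
  dat_A_gt1 : (1 < dat_A)%N;
  dat_A_coprime : coprime dat_A dat_p.-1;
  dat_Aq : (dat_A * dat_q * dat_p.-1 = (dat_p ^ dat_q).-1)%N;
  dat_j_coprime : coprime dat_j dat_n;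
  dat_r_dvd_j1 : dat_r %| dat_j.+1;
  dat_j1_coprime : coprime dat_j.+1 (dat_A * dat_q * dat_u)
}.

Lemma dat_q_dvd_n (D : semilinear_datum) : dat_q D %| dat_n D.
Proof. by rewrite /dat_n -mulnA dvdn_mulr // dvdn_mull. Qed.

Section SemilinearHeisenberg.
Set Implicit Arguments.
Unset Strict Implicit.
Unset Printing Implicit Defensive.
Import GroupScope Order.TTheory GRing.Theory Num.Theory.
Variable D : semilinear_datum.
Local Notation F := (dat_F D).
Local Notation c := (dat_c D).
Local Notation p := (dat_p D).
Local Notation q := (dat_q D).
Local Notation n := (dat_n D).
Local Notation j := (dat_j D).

Let n_gt0 : (0 < n)%N := prim_order_gt0 (dat_prim D).
Let p_gt0 : (0 < p)%N := prime_gt0 (dat_p_prime D).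

Lemma dat_pchar : p \in [pchar F]%R.
Proof. exact: card_finPcharP (dat_card D) (dat_p_prime D). Qed.

Lemma frob_mod k l (x : F) : k = l %[mod q] -> (x ^+ (p ^ k) = x ^+ (p ^ l))%R.
Proof.
have frobq t (y : F) : (y ^+ (p ^ (t * q)) = y)%R.
  elim: t => [|t IHt]; first by rewrite expr1.
  by rewrite mulSn expnD exprM -(dat_card D) expf_card.
by move=> kl; rewrite (divn_eq k q) (divn_eq l q) kl !expnD !exprM !frobq.
Qed.

(** Since p = 1 (mod q), the index [k + p ^ k * l] of a product is k + l modulo q. *)
Lemma expp_modq k l : p ^ k * l = l %[mod q].
Proof.
rewrite -modnMml -modnXm -[p]prednK // -addn1 -modnDml.
by rewrite (eqnP (dat_q_dvd D)) modnXm exp1n modnMml mul1n.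
Qed.

(* The element k of the index group acts as c^k sigma^k, for sigma the Frobenius
   map, and phi w is this action with the scalar raised to the weight w. *)
Definition phi (w k : nat) (x : F) : F := (c ^+ (w * k) * x ^+ (p ^ k))%R.

Arguments phi (w k)%_N x%_R.

Lemma phi_mod w k l x : k = l %[mod n] -> phi w k x = phi w l x.
Proof.
move=> kl; rewrite /phi; congr (_ * _)%R.
  apply/eqP; rewrite (eq_prim_root_expr (dat_prim D)).
  by rewrite -modnMmr kl modnMmr.
by apply: frob_mod; rewrite -(modn_dvdm _ (dat_q_dvd_n D)) kl modn_dvdm ?dat_q_dvd_n.
Qed.

Lemma phiD w k : {morph phi w k : x y / (x + y)%R}.
Proof.
move=> x y; rewrite /phi -mulrDr exprDn_pchar // pnatX.
by rewrite pnatE ?dat_p_prime ?dat_pchar.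
Qed.

Lemma phi0 w k : (phi w k 0 = 0)%R.
Proof. by rewrite /phi expr0n expn_eq0 -leqn0 leqNgt p_gt0 mulr0. Qed.

Lemma phiN w k x : (phi w k (- x) = - phi w k x)%R.
Proof. by apply: (addrI (phi w k x)); rewrite -phiD !subrr phi0. Qed.

Lemma phi1 w x : (phi w 0 x = x)%R.
Proof. by rewrite /phi muln0 expr0 mul1r. Qed.

(** Weights add, so the Heisenberg term a b' has weight 1 + j; this forces the weight of the z
    coordinate. *)
Lemma phiM w v k x y : (phi w k x * phi v k y = phi (w + v) k (x * y))%R.
Proof. by rewrite /phi exprMn mulnDl exprD mulrACA. Qed.

(** Composing c^k sigma^k with c^l sigma^l gives c^(k + p^k l) sigma^(k + l), and k + l may be
    replaced by k + p^k l in the exponent of sigma because they agree modulo q. This is the origin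
    of the index law. *)
Lemma phi_comp w k l x : phi w (k + p ^ k * l) x = phi w k (phi w l x).
Proof.
rewrite /phi exprMn mulrA -!exprM -exprD mulnDr; congr (_ * _)%R.
  by congr (_ ^+ (_ + _))%R; rewrite mulnCA mulnC.
rewrite -expnD addnC; apply: frob_mod.
by rewrite -modnDml expp_modq modnDml addnC.
Qed.

Record sheis := SHeis { sh_a : F; sh_b : F; sh_z : F; sh_k : 'I_n }.

Definition sheis_tuple (g : sheis) := (sh_a g, sh_b g, sh_z g, sh_k g).
Definition tuple_sheis t := let: (a, b, z, k) := t in SHeis a b z k.
Lemma sheis_tupleK : cancel sheis_tuple tuple_sheis.
Proof. by case. Qed.

Fact el_key : unit. Proof. exact: tt. Qed.
(* Locked, as otherwise unification unfolds products to recover [el]. *)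
Definition el (a b z : F) (k : nat) : sheis :=
  locked_with el_key (SHeis a b z (Ordinal (ltn_pmod k n_gt0))).

Arguments el (a b z)%_R k%_N.

Lemma elE a b z k : el a b z k = SHeis a b z (Ordinal (ltn_pmod k n_gt0)).
Proof. by rewrite /el unlock. Qed.

Lemma elP (g : sheis) : exists a b z k, g = el a b z k.
Proof.
case: g => a b z k; exists a, b, z, k; rewrite elE; congr SHeis.
by apply: val_inj; rewrite /= modn_small.
Qed.

Lemma eq_el a b z k l : k = l %[mod n] -> el a b z k = el a b z l.
Proof. by move=> kl; rewrite !elE; congr SHeis; apply: val_inj. Qed.

(** Semidirect product of the unitriangular 3 by 3 matrices over F, with a and b above the diagonal
    and z in the corner, by the group of indices. *)
Definition sheis_mul (g h : sheis) : sheis :=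
  let: SHeis a b z k := g in let: SHeis a' b' z' l := h in
  el (a + phi 1 k a') (b + phi j k b') (z + phi j.+1 k z' + a * phi j k b')
     (k + p ^ k * l).

Definition sheis_one : sheis := el 0 0 0 0.

(** This is - p^(-k) k modulo n: [n.-1] stands for -1 and, as p^q = 1 (mod n), [p ^ (k * q.-1)]
    stands for p^(-k). *)
Definition ind_inv k := ((n.-1) * (p ^ (k * q.-1) * k))%N.

Definition sheis_inv (g : sheis) : sheis :=
  let: SHeis a b z k := g in let l := ind_inv k in
  el (- phi 1 l a) (- phi j l b) (phi j.+1 l (a * b - z)) l.

Lemma pq_mod1 : p ^ q = 1 %[mod n].
Proof.
apply/eqP; rewrite -(eq_prim_root_expr (dat_prim D)).
by rewrite -(dat_card D) expf_card expr1.
Qed.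

Lemma expp_modn k l : k = l %[mod q] -> p ^ k = p ^ l %[mod n].
Proof.
have redq i : p ^ i = p ^ (i %% q) %[mod n].
  rewrite {1}(divn_eq i q) mulnC expnD expnM -modnMml -modnXm pq_mod1.
  by rewrite modnXm exp1n modnMml mul1n.
by move=> kl; rewrite redq kl -redq.
Qed.

(** As q divides n, k modulo n determines k modulo q, which in turn determines p^k modulo n. *)
Lemma modn_mulk k k' l l' : k = k' %[mod n] -> l = l' %[mod n] ->
  k + p ^ k * l = k' + p ^ k' * l' %[mod n].
Proof.
move=> kk' ll'; have kk'q: k = k' %[mod q].
  by rewrite -(modn_dvdm _ (dat_q_dvd_n D)) kk' modn_dvdm ?dat_q_dvd_n.
rewrite -modnDm kk' -[(p ^ k * l) %% n]modnMm (expp_modn kk'q) ll'.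
by rewrite modnMm modnDm.
Qed.

Lemma mul_el a b z k a' b' z' l :
  sheis_mul (el a b z k) (el a' b' z' l) =
  el (a + phi 1 k a') (b + phi j k b') (z + phi j.+1 k z' + a * phi j k b')
     (k + p ^ k * l).
Proof.
rewrite [el a b z k]elE [el a' b' z' l]elE /sheis_mul /= !(@phi_mod _ (k %% n) k) ?modn_mod //.
by apply: eq_el; apply: modn_mulk; rewrite modn_mod.
Qed.

Lemma ind_invP k : ind_inv k + p ^ ind_inv k * k = 0 %[mod n].
Proof.
(* Both sides are - k modulo q, which determines the power of p modulo n. *)
have eq_inv : ind_inv k = k * q.-1 %[mod q].
  rewrite /ind_inv mulnCA expp_modq.
  apply/eqP; rewrite -(eqn_modDr k) mulnC -{2}(muln1 k) -mulnDr.
  rewrite -{3}(muln1 k) -mulnDr !addn1 !prednK ?(prime_gt0 (dat_q_prime D)) //.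
  by rewrite -modnMmr (eqnP (dat_q_dvd_n D)) -[in X in _ == X]modnMmr modnn.
rewrite -modnDmr.
have ->: p ^ ind_inv k * k = p ^ (k * q.-1) * k %[mod n].
  by rewrite -modnMml (expp_modn eq_inv) modnMml.
rewrite modnDmr /ind_inv.
by rewrite -[X in _ + X]mul1n -mulnDl addn1 prednK // modnMr mod0n.
Qed.

Lemma sheis_mulA : associative sheis_mul.
Proof.
move=> g g' g''; have [a [b [z [k ->]]]] := elP g.
have [a' [b' [z' [k' ->]]]] := elP g'; have [a'' [b'' [z'' [k'' ->]]]] := elP g''.
rewrite !mul_el !phiD !phi_comp -[j.+1]add1n -phiM mulrDl !addrA.
set u := (_ + a * (_ + _))%R; set v := (_ + phi 1 k a' * _)%R.
have ->: u = v by rewrite {}/u {}/v; ring.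
apply: eq_el; rewrite mulnDr addnA mulnA -expnD -modnDmr -modnMml.
by rewrite (expp_modn (l := k + p ^ k * k')) ?modnMml ?modnDmr // -[RHS]modnDmr expp_modq modnDmr.
Qed.

Lemma sheis_mul1 : left_id sheis_one sheis_mul.
Proof.
move=> g; have [a [b [z [k ->]]]] := elP g.
by rewrite mul_el !phi1 !add0r mul0r addr0 add0n expn0 mul1n.
Qed.

Lemma sheis_mulV : left_inverse sheis_one sheis_inv sheis_mul.
Proof.
case=> a b z k; have ->: SHeis a b z k = el a b z k.
  by rewrite elE; congr SHeis; apply: val_inj; rewrite /= modn_small.
have ->: sheis_inv (el a b z k) = el (- phi 1 (ind_inv k) a)
  (- phi j (ind_inv k) b) (phi j.+1 (ind_inv k) (a * b - z)) (ind_inv k).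
  by rewrite [el a b z k]elE /= modn_small.
rewrite mul_el !addNr phiD phiN -[j.+1]add1n -phiM mulNr addrNK subrr.
exact/eq_el/ind_invP.
Qed.

End SemilinearHeisenberg.

HB.instance Definition _ (D : semilinear_datum) :=
  Finite.copy (sheis D) (can_type (@sheis_tupleK D)).
HB.instance Definition _ (D : semilinear_datum) :=
  Finite_isGroup.Build (sheis D) (@sheis_mulA D) (@sheis_mul1 D) (@sheis_mulV D).
Arguments el {D} (a b z)%_R k%_N.
Arguments phi {D} (w k)%_N x%_R.

(** * Subgroups cut out by coordinates, and their orders *)

Section Subgroups.
Set Implicit Arguments.
Unset Strict Implicit.
Unset Printing Implicit Defensive.
Import GroupScope Order.TTheory GRing.Theory Num.Theory.
Variable D : semilinear_datum.
Local Notation F := (dat_F D).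
Local Notation c := (dat_c D).
Local Notation p := (dat_p D).
Local Notation q := (dat_q D).
Local Notation n := (dat_n D).
Local Notation j := (dat_j D).
Local Notation gT := (sheis D).
Implicit Types (a b z x : F) (U V W : bool).

Let n_gt0 : (0 < n)%N := prim_order_gt0 (dat_prim D).
Let p_gt0 : (0 < p)%N := prime_gt0 (dat_p_prime D).

Lemma mulgE a b z k a' b' z' l :
  (el a b z k : gT) * el a' b' z' l =
  el (a + phi 1 k a') (b + phi j k b') (z + phi j.+1 k z' + a * phi j k b')
     (k + p ^ k * l).
Proof. exact: mul_el. Qed.

Lemma el_inj a b z k a' b' z' k' : el a b z k = el a' b' z' k' ->
  [/\ a = a', b = b', z = z' & k = k' %[mod n]].
Proof. by rewrite !elE; case. Qed.

Lemma el1 : (1 : gT) = el 0 0 0 0. Proof. by []. Qed.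

(* The flags U, V, W free the coordinates a, b, z, which otherwise vanish. *)
Definition coord_set U V W e : {set gT} :=
  [set g | [&& U || (sh_a g == 0%R), V || (sh_b g == 0%R), W || (sh_z g == 0%R)
             & e %| sh_k g]].

Lemma mem_coord_set U V W e a b z k : e %| n ->
  (el a b z k \in coord_set U V W e) =
  [&& U || (a == 0%R), V || (b == 0%R), W || (z == 0%R) & e %| k].
Proof. by move=> en; rewrite inE elE /= /dvdn modn_dvdm. Qed.

(** When a and b are both free, the terms a b' of products fill the z coordinate, which must then be
    free too. *)
Definition coord_ok U V W e := (W || ~~ (U && V)) && (e %| n).

Lemma coord_group_set U V W e : coord_ok U V W e -> group_set (coord_set U V W e).
Proof.
case/andP=> UVW en; apply/group_setP; split.
  by rewrite el1 mem_coord_set // eqxx !orbT dvdn0.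
move=> g h; have [a [b [z [k ->]]]] := elP g; have [a' [b' [z' [l ->]]]] := elP h.
rewrite mulgE !mem_coord_set // => /and4P[Ua Vb Wz ek] /and4P[Ua' Vb' Wz' el'].
rewrite dvdn_add ?dvdn_mull // andbT.
case: U UVW Ua Ua' => /= UVW; last move=> /eqP-> /eqP->;
case: V UVW Vb Vb' => /= UVW; try (move=> /eqP-> /eqP->);
case: W UVW Wz Wz' => //= _; try (move=> /eqP-> /eqP->);
by rewrite ?phi0 ?mul0r ?mulr0 ?addr0 ?eqxx.
Qed.

Definition coord_group U V W e (ok : coord_ok U V W e) : {group gT} :=
  Group (coord_group_set ok).

Lemma card_dvd_ord e : e %| n -> #|[set k : 'I_n | e %| k]| = n %/ e.
Proof.
move=> en; have e_gt0 : 0 < e by apply: dvdn_gt0 en.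
have lt_mul (i : 'I_(n %/ e)) : i * e < n by rewrite -ltn_divRL.
rewrite -[RHS]card_ord -(card_imset _ (f := fun i => Ordinal (lt_mul i))); last first.
  by move=> i i' /(congr1 val) /eqP; rewrite /= eqn_pmul2r // => /eqP/val_inj.
apply: eq_card => k; rewrite inE; apply/idP/imsetP=> [ek | [i _ ->]].
  have ltk: k %/ e < n %/ e by rewrite ltn_divRL // divnK.
  by exists (Ordinal ltk) => //; apply: val_inj; rewrite /= divnK.
exact: dvdn_mull.
Qed.

Lemma card_coord_set U V W e : e %| n ->
  #|coord_set U V W e| = (#|F| ^ (U + V + W) * (n %/ e))%N.
Proof.
move=> en; pose S U' := [set x : F | U' || (x == 0%R)].
have cS U' : #|S U'| = (#|F| ^ U')%N.
  case: U'; last by rewrite -[RHS](cards1 (0%R : F)); apply: eq_card => x; rewrite !inE.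
  by rewrite expn1 -cardsT; apply: eq_card => x; rewrite !inE.
rewrite -(card_imset _ (can_inj (@sheis_tupleK D))).
rewrite !expnD -!cS -(card_dvd_ord en) -!cardsX; apply: eq_card => -[[[a b] z] k].
rewrite !inE /= -!andbA; apply/imsetP/idP=> [[g] | abzk].
  by rewrite inE; case: g => a' b' z' k' /= abzk [-> -> -> ->].
by exists (SHeis a b z k); rewrite ?inE.
Qed.
End Subgroups.

(** * Derived and Fitting series *)

Section Structure.
Set Implicit Arguments.
Unset Strict Implicit.
Unset Printing Implicit Defensive.
Import GroupScope Order.TTheory GRing.Theory Num.Theory.
Variable D : semilinear_datum.
Local Notation F := (dat_F D).
Local Notation c := (dat_c D).
Local Notation p := (dat_p D).
Local Notation q := (dat_q D).
Local Notation n := (dat_n D).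
Local Notation j := (dat_j D).
Local Notation A := (dat_A D).
Local Notation u := (dat_u D).
Local Notation r := (dat_r D).
Local Notation gT := (sheis D).
Implicit Types (a b z x : F).

Let n_gt0 : (0 < n)%N := prim_order_gt0 (dat_prim D).
Let p_gt0 : (0 < p)%N := prime_gt0 (dat_p_prime D).

Lemma phi_fix w k x : coprime q w -> x != 0%R -> phi w k x = x -> n %| w * k.
Proof.
move=> cqw nzx fixx; rewrite (prim_order_dvd (dat_prim D)).
have cx : (c ^+ (w * k) * x ^+ (p ^ k).-1 = 1)%R.
  apply: (mulIf nzx); rewrite -mulrA -exprSr prednK ?expn_gt0 ?p_gt0 // mul1r.
  exact: fixx.
have x_ord : (x ^+ (p ^ q).-1 = 1)%R.
  apply: (mulIf nzx); rewrite -exprSr prednK ?expn_gt0 ?p_gt0 // mul1r.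
  by rewrite -dat_card expf_card.
(* p^k - 1 is a multiple of p - 1, and A q (p - 1) = p^q - 1 annihilates the multiplicative
   group. *)
have xpk : (x ^+ (p ^ k).-1 ^+ (A * q) = 1)%R.
  rewrite predn_exp -exprM mulnAC [(p.-1 * (A * q))%N]mulnC dat_Aq exprM x_ord.
  by rewrite expr1n.
have: n %| w * k * (A * q).
  rewrite (prim_order_dvd (dat_prim D)).
  have := congr1 (fun y => y ^+ (A * q))%R cx; rewrite exprMn expr1n xpk.
  by rewrite mulr1 -exprM => ->.
rewrite /dat_n -mulnA [(A * q * _)%N]mulnC.
have Aq_gt0 : 0 < A * q by rewrite muln_gt0 (ltnW (dat_A_gt1 D)) (prime_gt0 (dat_q_prime D)).
rewrite dvdn_pmul2r // => ur_wk.
(* q divides u, hence w k, and it is prime to w. Then sigma^k is trivial and [phi w k] is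
   multiplication by c^(w k), which fixes x only if it is 1. *)
have qk : q %| k.
  rewrite -(Gauss_dvdr _ cqw); apply: dvdn_trans ur_wk.
  by rewrite dvdn_mulr ?dat_q_dvd_u.
rewrite -(prim_order_dvd (dat_prim D)).
have := fixx; rewrite /phi (@frob_mod D k 0) ?expr1; last by rewrite mod0n; apply/eqP.
rewrite (prim_order_dvd (dat_prim D)) => /(canRL (mulfK nzx)); rewrite divff // => ->.
exact: eqxx.
Qed.

Lemma coprime_q_n w : coprime w n -> coprime q w.
Proof. by rewrite coprime_sym; apply: coprime_dvdl; apply: dat_q_dvd_n. Qed.

(** The map is additive and its kernel, the fixed points of [phi w k], is trivial by semiregularity;
    an injective self-map of a finite set is onto. *)
Lemma phi_sub_onto w k y : coprime q w -> ~~ (n %| w * k) -> exists x, (phi w k x - x = y)%R.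
Proof.
move=> cqw nwk; have inj : injective (fun x => phi w k x - x)%R.
  move=> x x' eq_x; apply/eqP; rewrite -subr_eq0; apply: contraR nwk => nz.
  apply: (phi_fix cqw nz).
  by rewrite phiD phiN -[phi w k x](subrK x) eq_x; ring.
have [f _ fK] := injF_bij inj; exists (f y); exact: fK.
Qed.

Lemma phi_onto w k y : exists x, phi w k x = y.
Proof.
have inj : injective (@phi D w k).
  move=> x x' eq_x; apply/eqP; rewrite -subr_eq0.
  have: (phi w k (x - x') == 0)%R by rewrite phiD phiN eq_x subrr.
  rewrite mulf_eq0 !expf_eq0 (prim_root_eq0 (dat_prim D)) eqn0Ngt n_gt0 andbF.
  by case/andP.
by have [f _ fK] := injF_bij inj; exists (f y); apply: fK.
Qed.

Lemma conj_el al be ze k a b z :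
  (el al be ze k : gT) * el a b z 0 =
  el (phi 1 k a) (phi j k b)
     (phi j.+1 k z + al * phi j k b - be * phi 1 k a) 0 * el al be ze k.
Proof.
rewrite !mulgE !phi1 muln0 addn0 expn0 mul1n add0n.
congr el; try by rewrite addrC.
ring.
Qed.

(** This serves subgroups containing P, where only the indices matter; the witnesses merely solve
    the equation for the coordinates in P. *)
Lemma conj_el_cyclic al be ze k a b z l l' :
  k + p ^ k * l = l' + p ^ l' * k %[mod n] ->
  exists a' b' z', (el al be ze k : gT) * el a b z l = el a' b' z' l' * el al be ze k.
Proof.
move=> kl.
exists (al + phi 1 k a - phi 1 l' al)%R, (be + phi j k b - phi j l' be)%R.
exists (ze + phi j.+1 k z + al * phi j k b - phi j.+1 l' ze -
 (al + phi 1 k a - phi 1 l' al) * phi j l' be)%R.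
rewrite !mulgE (eq_el _ _ _ kl); congr el; ring.
Qed.

Local Notation t := (q * u * r)%N.

Let shP_ok : coord_ok D true true true n. Proof. by rewrite /coord_ok dvdnn. Qed.
Let shZ_ok : coord_ok D false false true n. Proof. by rewrite /coord_ok dvdnn. Qed.
Let shE_ok : coord_ok D false true true n. Proof. by rewrite /coord_ok dvdnn. Qed.
Let shY_ok : coord_ok D false true false n. Proof. by rewrite /coord_ok dvdnn. Qed.
Let shB_ok : coord_ok D true true true q.
Proof. by rewrite /coord_ok dat_q_dvd_n. Qed.
Let shK_ok : coord_ok D true true true t.
Proof. by rewrite /coord_ok /dat_n -!mulnA dvdn_mull. Qed.
Let shT_ok : coord_ok D false true true (A * q * u).
Proof. by rewrite /coord_ok /dat_n dvdn_mulr. Qed.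

(* P is the Heisenberg group, Z its center, B = P : B_0 for B_0 the abelian subgroup of
   index q of H, K = P : C_A, and T = E : C_r is the inertia group of a character of E. *)
Definition shP := coord_group shP_ok.
Definition shZ := coord_group shZ_ok.
Definition shE := coord_group shE_ok.
Definition shY := coord_group shY_ok.
Definition shB := coord_group shB_ok.
Definition shK := coord_group shK_ok.
Definition shT := coord_group shT_ok.

Lemma mem_coord_group U V W e (ok : coord_ok D U V W e) a b z k :
  (el a b z k \in coord_group ok) =
  [&& U || (a == 0%R), V || (b == 0%R), W || (z == 0%R) & e %| k].
Proof. by apply: mem_coord_set; case/andP: ok. Qed.

Lemma coord_groupS U V W U' V' W' e e' (ok : coord_ok D U V W e)
    (ok' : coord_ok D U' V' W' e') :
  U ==> U' -> V ==> V' -> W ==> W' -> e' %| e -> coord_group ok \subset coord_group ok'.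
Proof.
move=> UU VV WW ee; apply/subsetP=> g; have [a [b [z [k ->]]]] := elP g.
rewrite !mem_coord_group => /and4P[Ua Vb Wz ek]; rewrite (dvdn_trans ee ek) andbT.
apply/and3P; split.
- by case/orP: Ua => [/(implyP UU)->|->]; rewrite ?orbT.
- by case/orP: Vb => [/(implyP VV)->|->]; rewrite ?orbT.
by case/orP: Wz => [/(implyP WW)->|->]; rewrite ?orbT.
Qed.

Definition mem_sh := (mem_coord_group shP_ok, mem_coord_group shZ_ok,
  mem_coord_group shE_ok, mem_coord_group shY_ok, mem_coord_group shB_ok,
  mem_coord_group shK_ok, mem_coord_group shT_ok).

Lemma el_dvd a b z k : n %| k -> el a b z k = el a b z 0.
Proof. by move=> nk; apply: eq_el; rewrite mod0n; apply/eqP. Qed.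

Lemma expp_dvd k : q %| k -> p ^ k = 1 %[mod n].
Proof. by move=> qk; rewrite (@expp_modn _ _ 0) // mod0n; apply/eqP. Qed.

Lemma mulp_dvd k l : q %| k -> p ^ k * l = l %[mod n].
Proof. by move=> qk; rewrite -modnMml expp_dvd // modnMml mul1n. Qed.

(** If q divides l, then p^l = 1 (mod n), so an element of index k conjugates the index l to p^k l,
    again a multiple of e. *)
Lemma cyclic_normal e (ok : coord_ok D true true true e) :
  q %| e -> coord_group ok <| setT.
Proof.
move=> qe; apply: normal_swap => g h.
have [al [be [ze [k ->]]]] := elP g; have [a [b [z [l ->]]]] := elP h.
rewrite (mem_coord_group ok) /= => el'; have ql := dvdn_trans qe el'.
have [|a' [b' [z' ->]]] := @conj_el_cyclic al be ze k a b z l (p ^ k * l).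
  by rewrite addnC -modnDmr -[RHS]modnDmr mulp_dvd // dvdn_mull.
by eexists; last by []; rewrite (mem_coord_group ok) /= dvdn_mull.
Qed.

Lemma shP_normal : shP <| setT. Proof. exact/cyclic_normal/dat_q_dvd_n. Qed.
Lemma shB_normal : shB <| setT. Proof. exact/cyclic_normal. Qed.
Lemma shE_normal : shE <| setT.
Proof.
apply: normal_swap => g h.
have [al [be [ze [k ->]]]] := elP g; have [a [b [z [l ->]]]] := elP h.
rewrite mem_sh /= => /andP[/eqP-> nl]; rewrite (el_dvd _ _ _ nl) conj_el.
by eexists; last by []; rewrite mem_sh /= phi0 eqxx dvdn0.
Qed.

Lemma el_comm_index a b z k a' b' z' l a'' b'' z'' i :
  el a b z k * el a' b' z' l = el a'' b'' z'' i * (el a' b' z' l * el a b z k) :> gT ->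
  k + p ^ k * l = i + p ^ i * (l + p ^ l * k) %[mod n].
Proof. by rewrite !mulgE => /el_inj[]. Qed.

Lemma el_comm_q a b z k a' b' z' l a'' b'' z'' i :
  el a b z k * el a' b' z' l = el a'' b'' z'' i * (el a' b' z' l * el a b z k) :> gT ->
  q %| i.
Proof.
move/el_comm_index => eq_n; have := eq_n.
move/(congr1 (modn^~ q)); rewrite !modn_dvdm ?dat_q_dvd_n //.
rewrite -modnDmr expp_modq modnDmr -[RHS]modnDmr expp_modq modnDmr.
rewrite addnA -[RHS]modnDmr expp_modq modnDmr -addnA [l + k]addnC.
by rewrite -[X in X = _ %[mod _]]add0n => /eqP; rewrite eqn_modDr eq_sym mod0n.
Qed.

Lemma der1_sub_shB : [set: gT]^`(1) \subset shB.
Proof.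
apply: commg_sub_swap => g h w _ _.
have [a [b [z [k ->]]]] := elP g; have [a' [b' [z' [l ->]]]] := elP h.
have [a'' [b'' [z'' [i ->]]]] := elP w => /el_comm_q qi.
by rewrite mem_sh.
Qed.

(** On multiples of q the index law is plain addition modulo n, so commutators have index 0. *)
Lemma shB_der1 : shB^`(1) \subset shP.
Proof.
apply: commg_sub_swap => g h w.
have [a [b [z [k ->]]]] := elP g; have [a' [b' [z' [l ->]]]] := elP h.
have [a'' [b'' [z'' [i ->]]]] := elP w.
rewrite !mem_sh /= => qk ql ghw.
have qi := el_comm_q ghw; have := el_comm_index ghw.
rewrite -modnDmr mulp_dvd // modnDmr -[RHS]modnDmr mulp_dvd // modnDmr.
rewrite addnA -[RHS]modnDmr mulp_dvd // modnDmr -addnA [l + k]addnC.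
by rewrite -[X in X = _ %[mod _]]add0n => /eqP; rewrite eqn_modDr eq_sym mod0n.
Qed.

Lemma shP_el g : g \in shP -> exists a b z, g = el a b z 0.
Proof.
have [a [b [z [k ->]]]] := elP g; rewrite mem_sh /= => nk.
by exists a, b, z; apply: el_dvd.
Qed.

Lemma shP_der1 : shP^`(1) \subset shZ.
Proof.
apply: commg_sub_swap => g h w Pg Ph.
have [a [b [z ->]]] := shP_el Pg; have [a' [b' [z' ->]]] := shP_el Ph.
have [a'' [b'' [z'' [i ->]]]] := elP w => ghw.
have ni : n %| i.
  have := el_comm_index ghw; rewrite !(muln0, addn0) mod0n.
  by move/esym/eqP.
move: ghw; rewrite (el_dvd _ _ _ ni) !mulgE !phi1 => /el_inj[Ea Eb _ _].
have ->: a'' = 0%R by apply: (@addIr _ (a' + a)%R); rewrite -Ea add0r addrC.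
have ->: b'' = 0%R by apply: (@addIr _ (b' + b)%R); rewrite -Eb add0r addrC.
by rewrite mem_sh /= !eqxx dvdn0.
Qed.

Lemma shE_abelian : abelian shE.
Proof.
apply/centsP=> g; have [a [b [z [k ->]]]] := elP g.
rewrite mem_sh /= => /andP[/eqP-> nk] h.
have [a' [b' [z' [k' ->]]]] := elP h.
rewrite mem_sh /= => /andP[/eqP-> nk'].
rewrite /commute (el_dvd _ _ _ nk) (el_dvd _ _ _ nk') !mulgE !phi1 !mul0r !addr0.
by congr el; rewrite addrC.
Qed.

Lemma shZ_sub_commg : shZ \subset [~: shP, shP].
Proof.
apply/subsetP=> g; have [a [b [z [k ->]]]] := elP g.
rewrite mem_sh /= => /and3P[/eqP-> /eqP-> nk]; rewrite (el_dvd _ _ _ nk).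
apply: (@swap_mem_commg gT shP shP (el z 0 0 0) (el 0 1 0 0)).
- by rewrite mem_sh /= dvdn0.
- by rewrite mem_sh /= dvdn0.
by rewrite !mulgE !phi1 !mul0r !mulr1 !add0r !addr0.
Qed.

(** An element of L outside P has nonzero index modulo n, so by semiregularity its commutators with
    P cover P / Z, while Z lies in [P, P]. The derived series, the Fitting subgroup and an inertia
    group are all derived from this. *)
Lemma sub_shP_commg (L : {group gT}) :
  shP \subset L -> ~~ (L \subset shP) -> shP \subset [~: shP, L].
Proof.
move=> sPL /subsetPn[g Lg notPg].
have sZ : shZ \subset [~: shP, L] by apply: subset_trans shZ_sub_commg _; apply: commgS.
move: g Lg notPg => g; have [al [be [ze [k ->]]]] := elP g => Lg.
rewrite mem_sh /= => nk.
apply/subsetP=> h Ph; have [a [b [z ->]]] := shP_el Ph.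
have n1k : ~~ (n %| 1 * k) by rewrite mul1n.
have [a0 Da] := phi_sub_onto a (coprimen1 q) n1k.
have njk : ~~ (n %| j * k) by rewrite Gauss_dvdr // coprime_sym dat_j_coprime.
have [b0 Db] := phi_sub_onto b (coprime_q_n (dat_j_coprime D)) njk.
(* The z coordinate of the commutator of the chosen element with [el a0 b0 0 0]; the discrepancy z -
   z0 is corrected inside Z. *)
set z0 := (al * phi j k b0 - be * phi 1 k a0 - a * b0)%R.
have w_comm : el a b z0 0 \in [~: shP, L].
  rewrite commGC; apply: (@swap_mem_commg gT L shP _ (el a0 b0 0 0) _ Lg).
    by rewrite mem_sh /= dvdn0.
  rewrite conj_el mulgA; congr (_ * _).
  rewrite mulgE !phi1 -Da -Db !subrK; congr el.
  by rewrite /z0 phi0 Da; ring.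
have -> : el a b z 0 = el 0 0 (z - z0) 0 * el a b z0 0 :> gT.
  by rewrite mulgE !phi1 mul0r !add0r addr0 subrK.
rewrite groupM // (subsetP sZ) // mem_sh /= !eqxx dvdn0 //.
Qed.

Lemma shP_subB : shP \subset shB.
Proof. by apply: coord_groupS; rewrite ?dat_q_dvd_n. Qed.

Lemma shP_subK : shP \subset shK.
Proof. by apply: coord_groupS => //; case/andP: shK_ok. Qed.

Lemma shK_notP : ~~ (shK \subset shP).
Proof.
apply/subsetPn; exists (el 0 0 0 t); rewrite !mem_sh /=; first exact: dvdnn.
have [t0 nE] : 0 < t /\ n = (A * t)%N.
  split; last by rewrite /dat_n -!mulnA.
  by move: n_gt0; rewrite /dat_n -!mulnA !muln_gt0 => /andP[].
apply/negP=> /(dvdn_leq t0); rewrite nE -{2}[t]mul1n leq_pmul2r //.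
by rewrite leqNgt dat_A_gt1.
Qed.

Lemma setT_notP : ~~ ([set: gT] \subset shP).
Proof. by apply: contra shK_notP; apply: subset_trans; apply: subsetT. Qed.

(** Conjugation by the element of index 1 multiplies the indices in C_A by p, and p - 1 is
    invertible modulo A, so the commutators fill C_A. Thus G' is not in P and G / P is not
    nilpotent. *)
Lemma shK_sub_commg : shK \subset [~: shK, setT].
Proof.
have sPKG : shP \subset [~: shK, setT].
  apply: subset_trans (sub_shP_commg (subsetT _) setT_notP) _.
  by rewrite commSg ?shP_subK.
apply/subsetP=> g; have [a [b [z [k ->]]]] := elP g; rewrite mem_sh /= => tk.
have qt : q %| t by rewrite -mulnA dvdn_mulr.
have qk := dvdn_trans qt tk.
have -> : el a b z k = el a b z 0 * el 0 0 0 k :> gT.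
  by rewrite mulgE !phi1 mulr0 !addr0 expn0 mul1n.
rewrite groupM //; first by rewrite (subsetP sPKG) // mem_sh /= dvdn0.
(* By Euler's theorem the power is an inverse of p - 1 modulo A; as k is a multiple of t = n / A,
   this gives (p - 1) l = k modulo n. *)
pose l := (p.-1 ^ (totient A).-1 * k)%N.
have tl : t %| l by rewrite dvdn_mull.
have ql := dvdn_trans qt tl.
have Dl : p.-1 * l = k %[mod n].
  rewrite /l mulnA -expnS prednK ?totient_gt0 ?(ltnW (dat_A_gt1 D)) //.
  have /dvdnP[k' ->] := tk.
  have -> : n = (A * t)%N by rewrite /dat_n -!mulnA.
  rewrite mulnA -!muln_modl; congr (_ * _)%N.
  by rewrite -modnMml Euler_exp_totient ?modnMml ?mul1n // coprime_sym dat_A_coprime.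
suffices: el 0 0 0 k \in [~: [set: gT], shK] by rewrite commGC.
apply: (@swap_mem_commg gT setT shK (el 0 0 0 1) (el 0 0 0 l)).
- exact: in_setT.
- by rewrite mem_sh.
rewrite !mulgE !(phi0, mulr0, addr0); apply: eq_el.
rewrite expn1 muln1 -[RHS]modnDmr mulp_dvd // -[RHS]modnDml -Dl modnDml.
rewrite modnDmr addnA -mulSnr prednK // addnC -[RHS]modnDmr.
by rewrite (expp_dvd ql) modnDmr.
Qed.

(** Bounds from both sides give G'' = P and G''' = Z, which is abelian and nontrivial. *)
Lemma derived_length_sheis : derived_length_is [set: gT] 4.
Proof.
have notG1 : ~~ ([set: gT]^`(1) \subset shP).
  apply: contra shK_notP; apply: subset_trans.
  by apply: subset_trans shK_sub_commg _; rewrite commSg ?subsetT.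
have sP1 : shP \subset [set: gT]^`(1).
  apply: subset_trans (sub_shP_commg (subsetT _) setT_notP) _.
  by rewrite commSg ?subsetT.
have sP2 : shP \subset [set: gT]^`(2).
  by apply: subset_trans (sub_shP_commg sP1 notG1) _; rewrite commSg.
have sZ3 : shZ \subset [set: gT]^`(3).
  by apply: subset_trans shZ_sub_commg _; rewrite commgSS.
have G2P : [set: gT]^`(2) \subset shP.
  by apply: subset_trans shB_der1; rewrite commgSS ?der1_sub_shB.
have G3Z : [set: gT]^`(3) \subset shZ.
  by apply: subset_trans shP_der1; rewrite commgSS.
split.
  apply/trivgP; apply: subset_trans (commgSS G3Z G3Z) _.
  have abZ : abelian shZ.
    by apply: abelianS shE_abelian; apply: coord_groupS.
  by rewrite (commG1P abZ).
have nzZ : shZ :!=: 1.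
  apply/trivgPn; exists (el 0 0 1 0); first by rewrite mem_sh !eqxx dvdn0.
  by apply/eqP; rewrite el1 => /el_inj[_ _ /eqP]; rewrite oner_eq0.
move=> m ltm; apply: contraNneq nzZ => Gm1; apply/eqP/trivgP.
apply: subset_trans sZ3 _; rewrite -Gm1.
case: m ltm {Gm1} => [|[|[|[|//]]]] _; last exact: subxx.
- exact: (der_sub 3 [set: gT]).
- exact: (der_sub 2 [set: gT]^`(1)).
exact: (der_sub 1 [set: gT]^`(2)).
Qed.

Lemma pgroup_shP : p.-group shP.
Proof.
rewrite /pgroup card_coord_set // divnn n_gt0 muln1 dat_card -expnM.
by rewrite pnatX pnat_id ?dat_p_prime.
Qed.

Lemma Fitting_sheis : 'F([set: gT]) = shP.
Proof.
apply/eqP; rewrite eqEsubset.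
have sPF : shP \subset 'F([set: gT]).
  by rewrite Fitting_max ?shP_normal ?(pgroup_nil pgroup_shP).
rewrite sPF andbT; apply: contraT => notFP.
(* In a nilpotent group F a subgroup contained in its own commutator with F is trivial; if F were
   not inside P, this would apply to P. *)
have := Fitting_nil [set: gT]; rewrite /nilpotent => /forallP/(_ shP)/implyP.
rewrite subsetI sPF sub_shP_commg // => /(_ isT)/eqP P1.
have : el 1 0 0 0 \in shP by rewrite mem_sh dvdn0.
by rewrite P1 inE el1 => /eqP/el_inj[/eqP]; rewrite oner_eq0.
Qed.

Lemma not_nilpotent_quotient : ~~ nilpotent ([set: gT] / shP).
Proof.
have nP (H : {set gT}) : H \subset 'N(shP).
  exact: subset_trans (subsetT H) (normal_norm shP_normal).
apply/negP; rewrite /nilpotent => /forallP/(_ (shK / shP)%G)/implyP.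
rewrite subsetI quotientS ?subsetT // -quotientR ?nP // quotientS ?shK_sub_commg //.
by move/(_ isT); rewrite -subG1 quotient_sub1 ?nP // (negPf shK_notP).
Qed.

(** The second term F2 contains B, as B / P is abelian, so G / F2 is abelian; and F2 is not G, as G
    / P is not nilpotent. *)
Lemma fitting_height_sheis : fitting_height_is [set: gT] 3.
Proof.
have F1 : fitting_series [set: gT] 1 = shP by rewrite /= preim_Fitting1 Fitting_sheis.
pose F2 := (coset shP @*^-1 'F([set: gT] / shP))%G.
have DF2 : fitting_series [set: gT] 2 = F2.
  by rewrite -[LHS]/(coset (fitting_series [set: gT] 1) @*^-1
    'F([set: gT] / fitting_series [set: gT] 1)) F1.
have nPG := normal_norm shP_normal.
have sBF2 : shB \subset F2.
  rewrite -sub_quotient_pre; last exact: subset_trans (subsetT _) nPG.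
  rewrite Fitting_max ?quotient_normal ?shB_normal // abelian_nil //.
  by rewrite sub_der1_abelian ?shB_der1.
split.
  rewrite -[LHS]/(coset (fitting_series [set: gT] 2) @*^-1
    'F([set: gT] / fitting_series [set: gT] 2)) DF2.
  have nsF2 : F2 <| setT.
    by rewrite -[X in _ <| X](quotientGK shP_normal) cosetpre_normal Fitting_normal.
  rewrite nilpotent_Fitting ?quotientGK //.
  rewrite abelian_nil // sub_der1_abelian //.
  exact: subset_trans der1_sub_shB sBF2.
case=> [|[|[|//]]] _.
- by apply: contraNneq setT_notP => <-; apply: (sub1G shP).
- by apply: contraNneq setT_notP; rewrite F1 => ->.
apply: contraNneq not_nilpotent_quotient; rewrite DF2 => F2G.
have : F2 / shP = 'F([set: gT] / shP) by exact: cosetpreK.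
by rewrite F2G => ->; apply: Fitting_nil.
Qed.

(** * Character degrees *)

Lemma card_sheis : #|[set: gT]| = (#|F| ^ 3 * n)%N.
Proof.
rewrite -[n]divn1 -(@card_coord_set D true true true 1) ?dvd1n //.
by apply: eq_card => g; rewrite !inE dvd1n.
Qed.

Lemma indexg_coord U V W e (ok : coord_ok D U V W e) :
  (#|F| ^ (U + V + W) * #|[set: gT] : coord_group ok| = #|F| ^ 3 * e)%N.
Proof.
have en : e %| n by case/andP: ok.
have cG : (#|F| ^ (U + V + W) * (n %/ e) * #|[set: gT] : coord_group ok| =
    #|F| ^ 3 * n)%N.
  by have := Lagrange (subsetT (coord_group ok)); rewrite card_coord_set // card_sheis.
apply/eqP; rewrite -(eqn_pmul2r (_ : 0 < n %/ e)) ?divn_gt0 ?(dvdn_gt0 _ en) //;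
  last exact: dvdn_leq.
by rewrite mulnAC cG -mulnA [(e * _)%N]mulnC divnK.
Qed.

Let cardF_gt0 i : 0 < #|F| ^ i.
Proof. by rewrite expn_gt0 (ltn_trans _ (finNzRing_gt1 F)). Qed.

(** B has prime index q, so the inertia group of a character of B is B or G, and its quotient by B
    is cyclic in either case. *)
Lemma irr1_over_shP (k : Iirr [set: gT]) : shP \subset cfker ('chi_k)%R ->
  ('chi_k)%R 1%g \in [:: 1%R; (q%:R)%R].
Proof.
move=> kerP; have [i ik] := constt_cfRes_irr (shB) k.
have lin_i : ('chi_i)%R \is a linear_char.
  rewrite lin_irr_der1 (subset_trans shB_der1) //.
  apply: subset_trans (cfker_constt (cfRes_char _ (irr_char k)) ik).
  by apply: sub_cfker_Res => //; apply: shP_subB.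
have idxB : #|[set: gT] : shB| = q.
  apply/eqP; rewrite -(eqn_pmul2l (cardF_gt0 3)); apply/eqP.
  exact: (indexg_coord shB_ok).
have sBT : shB \subset 'I_[set: gT][('chi_i)%R] by rewrite sub_Inertia ?subsetT.
have := Lagrange_index (Inertia_sub _ _) sBT; rewrite idxB => mul_idx.
have cycT : cyclic ('I_[set: gT][('chi_i)%R] / shB).
  have : #|'I_[set: gT][('chi_i)%R] / shB| %| q.
    by rewrite card_quotient ?norm_Inertia // -mul_idx dvdn_mull.
  case/primeP: (dat_q_prime D) => _ qP /qP/orP[/eqP/card1_trivg-> | /eqP Tq].
    exact: cyclic1.
  by rewrite prime_cyclic // Tq dat_q_prime.
rewrite (irr1_cyclic_inertia_quotient shB_normal lin_i cycT ik).
have : #|[set: gT] : 'I_[set: gT][('chi_i)%R]| %| q by rewrite -mul_idx dvdn_mulr.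
case/primeP: (dat_q_prime D) => _ qP /qP /orP[]/eqP->; by rewrite !inE eqxx ?orbT.
Qed.

(** If the inertia group T were larger than P, then P would lie in [P, T] and so in the kernel of
    the constituent, which was chosen nontrivial. *)
Lemma irr1_over_shZ (k : Iirr [set: gT]) :
    shZ \subset cfker ('chi_k)%R -> ~~ (shP \subset cfker ('chi_k)%R) ->
  ('chi_k)%R 1%g = (n%:R)%R.
Proof.
move=> kerZ nkerP; have [i ik nkeri] := constt_Res_cfker (subsetT _) (subxx _) nkerP.
have sZP : shZ \subset shP by apply: coord_groupS.
have lin_i : ('chi_i)%R \is a linear_char.
  rewrite lin_irr_der1 (subset_trans shP_der1) //.
  apply: subset_trans (cfker_constt (cfRes_char _ (irr_char k)) ik).
  exact: sub_cfker_Res.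
have DT : 'I_[set: gT][('chi_i)%R] = shP.
  apply/eqP; rewrite eqEsubset sub_Inertia ?subsetT // andbT.
  apply: contraR nkeri => nTP.
  apply: subset_trans (sub_shP_commg (L := 'I_[set: gT][('chi_i)%R]%G) _ nTP) _.
    by rewrite sub_Inertia ?subsetT.
  by apply: commg_inertia_cfker lin_i _; rewrite subsetIr.
have idxP : #|[set: gT] : shP| = n.
  apply/eqP; rewrite -(eqn_pmul2l (cardF_gt0 3)); apply/eqP.
  exact: (indexg_coord shP_ok).
rewrite (irr1_cyclic_inertia_quotient shP_normal lin_i _ ik) DT ?idxP //.
by rewrite trivg_quotient cyclic1.
Qed.

Lemma shZ_subE : shZ \subset shE. Proof. exact: coord_groupS. Qed.
Lemma shY_subE : shY \subset shE. Proof. exact: coord_groupS. Qed.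

Lemma card_shY : #|shY| = #|F|.
Proof. by rewrite card_coord_set // divnn n_gt0 muln1 expn1. Qed.

Lemma shE_el g : g \in shE -> exists b z, g = el 0 b z 0.
Proof.
have [a [b [z [k ->]]]] := elP g; rewrite mem_sh /= => /andP[/eqP-> nk].
by exists b, z; apply: el_dvd.
Qed.

Lemma mem_elE b z : el 0 b z 0 \in shE.
Proof. by rewrite mem_sh eqxx dvdn0. Qed.

Lemma mul_elE b z b' z' : el 0 b z 0 * el 0 b' z' 0 = el 0 (b + b') (z + z') 0 :> gT.
Proof. by rewrite mulgE !phi1 mul0r !addr0. Qed.

Lemma lin_shZ_ker (phi : 'CF(shE)) : phi \is a linear_char ->
  (forall z, phi (el 0 0 z 0) = 1%R) -> shZ \subset cfker phi.
Proof.
move=> lin_phi phi1; apply/subsetP=> g Zg; have [b [z Dg]] := shE_el (subsetP shZ_subE g Zg).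
move: Zg; rewrite {}Dg mem_sh => /and4P[_ /eqP-> _ _].
by rewrite cfkerEchar ?lin_charW // inE mem_elE phi1 lin_char1 /=.
Qed.

(* The pairing (a, b) |-> nu (a b), for nu the restriction of the character to shZ, is
   nondegenerate, so that each character of shY is of the form b |-> nu (a b). *)
Lemma conj_trivial_on_shY (i : Iirr shE) :
  ~~ (shZ \subset cfker ('chi_i)%R) ->
  exists a, forall b z,
    (('chi_i)%R ^ el a 0 0 0)%CF (el 0 b z 0) = ('chi_i)%R (el 0 0 z 0).
Proof.
move=> nkeri; have lin_i : ('chi_i)%R \is a linear_char by apply/char_abelianP/shE_abelian.
have nE g : g \in 'N(shE).
  by rewrite (subsetP (normal_norm shE_normal)) ?in_setT.
have conjE a b z : (('chi_i)%R ^ el a 0 0 0)%CF (el 0 b z 0) = ('chi_i)%R (el 0 b (z + a * b) 0).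
  rewrite cfConjgE //; congr (('chi_i)%R _).
  apply: (mulIg (el a 0 0 0)); rewrite conjgE invgK mulgA mulgKV.
  by rewrite !mulgE !phi1 !(add0r, addr0, mulr0, mul0r) add0n expn0.
pose f a := cfIirr ('Res[shY] (('chi_i)%R ^ el a 0 0 0)%CF)%R.
have fE a : ('chi_(f a) = 'Res[shY] (('chi_i)%R ^ el a 0 0 0)%CF)%R.
  by rewrite cfIirrE // lin_char_irr // cfRes_lin_char ?cfConjg_lin_char.
have memY b : el 0 b 0 0 \in shY by rewrite mem_sh !eqxx dvdn0.
have f_val a b : ('chi_(f a))%R (el 0 b 0 0) = ('chi_i)%R (el 0 b (a * b) 0).
  by rewrite fE cfResE ?shY_subE // conjE add0r.
have f_inj : injective f.
  move=> a a' eq_f; apply/eqP; rewrite -subr_eq0; apply: contraR nkeri => nz.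
  apply: lin_shZ_ker => // z.
  have := f_val a (z / (a - a'))%R; rewrite eq_f f_val.
  set b := (z / _)%R; have -> : (a * b = a' * b + z)%R.
    by rewrite -[z in RHS](divfK nz) -/b; ring.
  have -> : el 0 b (a' * b + z) 0 = el 0 b (a' * b) 0 * el 0 0 z 0 :> gT.
    by rewrite mul_elE addr0.
  rewrite lin_charM ?mem_elE // -[LHS]mulr1.
  by move/(mulfI (lin_char_neq0 lin_i (mem_elE _ _))).
have cardY : #|Iirr shY| = #|F|.
  by rewrite card_Iirr_abelian ?card_shY // (abelianS shY_subE) ?shE_abelian.
(* [f] is injective between sets of equal size, hence takes the value 0, the index of the trivial
   character. *)
have [a f0] : exists a, 0%R = f a.
  by apply/codomP; rewrite inj_card_onto // cardY.
exists a => b z; rewrite conjE.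
have := f_val a b; rewrite -f0 irr0 cfun1E memY => f1.
have -> : el 0 b (z + a * b) 0 = el 0 b (a * b) 0 * el 0 0 z 0 :> gT.
  by rewrite mul_elE addr0 addrC.
by rewrite lin_charM ?mem_elE // -f1 mul1r.
Qed.

Let s := (A * q * u)%N.

Lemma q_coprime_j1 : coprime q j.+1.
Proof.
rewrite coprime_sym; apply: coprime_dvdr (dat_j1_coprime D).
by rewrite mulnAC dvdn_mull.
Qed.

(** r divides j + 1 while j + 1 is prime to s = n / r; so the part of H acting trivially on Z is the
    subgroup C_r of indices divisible by s. *)
Lemma dvd_j1 k : (n %| j.+1 * k) = (s %| k).
Proof.
apply/idP/idP=> [nk | sk].
  have : s %| j.+1 * k by apply: dvdn_trans nk; rewrite /dat_n dvdn_mulr.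
  by rewrite Gauss_dvdr // coprime_sym dat_j1_coprime.
by rewrite /dat_n mulnC dvdn_mul ?dat_r_dvd_j1.
Qed.

Lemma phi_j1 k z : s %| k -> phi j.+1 k z = z.
Proof.
move=> sk; rewrite /phi (@frob_mod D k 0); last first.
  rewrite mod0n; apply/eqP; apply: dvdn_trans sk.
  by rewrite /s mulnAC dvdn_mull.
rewrite expr1; have := dvd_j1 k; rewrite sk (prim_order_dvd (dat_prim D)) => /eqP->.
by rewrite mul1r.
Qed.

Lemma cyclic_shTE : cyclic (shT / shE).
Proof.
pose g : gT := el 0 0 0 s.
have qs : q %| s by rewrite /s mulnAC dvdn_mull.
have gX i : g ^+ i = el 0 0 0 (s * i).
  elim: i => [|i IHi]; first by rewrite muln0 expg0.
  rewrite expgS IHi mulgE !(phi0, mulr0, addr0); apply: eq_el.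
  by rewrite -modnDmr mulp_dvd // modnDmr mulnS.
apply: cyclicS (cycle_cyclic (coset shE g)).
apply/subsetP=> _ /morphimP[h _ Th ->].
move: Th; have [a [b [z [k ->]]]] := elP h; rewrite mem_sh => /and4P[/eqP-> _ _ /dvdnP[i ->]].
have nE y : y \in 'N(shE) by rewrite (subsetP (normal_norm shE_normal)) ?in_setT.
have -> : el 0 b z (i * s) = el 0 b z 0 * g ^+ i.
  by rewrite gX mulgE !phi1 !(mulr0, addr0) expn0 mul1n mulnC.
by rewrite morphM //= coset_id ?mem_elE // mul1g morphX // mem_cycle.
Qed.

Lemma irr1_not_over_shZ (k : Iirr [set: gT]) : ~~ (shZ \subset cfker ('chi_k)%R) ->
  ('chi_k)%R 1%g = ((p ^ q * s)%:R)%R.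
Proof.
move=> nkerZ; have [i0 ik0 nkeri0] := constt_Res_cfker (subsetT _) shZ_subE nkerZ.
have [a phiE] := conj_trivial_on_shY nkeri0.
pose i := conjg_Iirr i0 (el a 0 0 0).
have iE b z : ('chi_i)%R (el 0 b z 0) = ('chi_i0)%R (el 0 0 z 0).
  by rewrite conjg_IirrE phiE.
have ik : i \in irr_constt ('Res[shE] 'chi_k)%R.
  by rewrite irr_consttE conjg_IirrE cfdot_Res_conjg ?in_setT.
have lin0 : ('chi_i0)%R \is a linear_char by apply/char_abelianP/shE_abelian.
have lin_i : ('chi_i)%R \is a linear_char by apply/char_abelianP/shE_abelian.
have neri : ~~ (shZ \subset cfker ('chi_i)%R).
  apply: contra nkeri0 => keri; apply: lin_shZ_ker => // z.
  rewrite -(iE 0%R) cfker1 ?lin_char1 // (subsetP keri) //.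
  by rewrite mem_sh !eqxx dvdn0.
have DT : 'I_[set: gT][('chi_i)%R] = shT.
  apply/eqP; rewrite eqEsubset; apply/andP; split.
    apply/subsetP=> g Tg; have [al [be [ze [l Dg]]]] := elP g.
    have val_g b z b' z' : g * el 0 b z 0 = el 0 b' z' 0 * g ->
        ('chi_i0)%R (el 0 0 z 0) = ('chi_i0)%R (el 0 0 z' 0).
      move=> swap; rewrite -(iE b) -(iE b').
      have /setIP[_ Ig] := groupVr Tg.
      rewrite -(inertia_valJ _ Ig); congr (('chi_i)%R _).
      by rewrite conjgE invgK mulgA swap mulgK.
    have ker0 z z' : ('chi_i0)%R (el 0 0 z 0) = ('chi_i0)%R (el 0 0 z' 0) ->
        ('chi_i0)%R (el 0 0 (z' - z) 0) = 1%R.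
      have -> : el 0 0 z' 0 = el 0 0 z 0 * el 0 0 (z' - z) 0 :> gT.
        by rewrite mul_elE addr0 addrC subrK.
      rewrite lin_charM ?mem_elE // -[LHS]mulr1.
      by move/(mulfI (lin_char_neq0 lin0 (mem_elE _ _))).
    rewrite Dg mem_sh /= andbC; apply/andP; split.
      (* If s does not divide l, every z is a difference [phi j.+1 l z0 - z0], and a character fixed
         by g is trivial on those. *)
      apply: contraR nkeri0; rewrite -dvd_j1 => nl; apply: lin_shZ_ker => // z.
      have [z0 <-] := phi_sub_onto z q_coprime_j1 nl.
      apply: ker0; apply: (val_g 0%R _ 0%R).
      by rewrite Dg conj_el !phi0 !mulr0 subr0 addr0.
    (* If al is nonzero, g conjugates [el 0 b 0 0] to an element with z coordinate [al * phi j l b],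
       which is any prescribed z for a suitable b. *)
    apply: contraR nkeri0 => nz; apply: lin_shZ_ker => // z.
    have [b Db] := phi_onto j l (z / al)%R.
    rewrite -[z]subr0; apply: ker0; apply: (val_g b _ (phi j l b)).
    rewrite Dg conj_el !phi0 mulr0 subr0 add0r Db [(al * _)%R]mulrC divfK //.
  have nE y : y \in 'N(shE) by rewrite (subsetP (normal_norm shE_normal)) ?in_setT.
  apply/subsetP=> g; have [al [be [ze [l ->]]]] := elP g.
  rewrite mem_sh => /and4P[/eqP-> _ _ sl]; apply/setIP; split; first exact: in_setT.
  apply/setIdP; split; rewrite ?nE //; apply/eqP/cfun_inP=> h Eh.
  have [b [z ->]] := shE_el Eh.
  rewrite cfConjgE ?nE // iE.
  rewrite -[z in RHS](phi_j1 z sl) -(iE (phi j l b)); congr (('chi_i)%R _).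
  apply: (mulIg (el 0 be ze l)); rewrite conjgE invgK mulgA mulgKV.
  by rewrite conj_el phi0 mul0r mulr0 subr0 addr0.
have idxT : #|[set: gT] : shT| = (#|F| * s)%N.
  apply/eqP; rewrite -(eqn_pmul2l (cardF_gt0 2)) mulnA -expnSr; apply/eqP.
  exact: (indexg_coord shT_ok).
rewrite (irr1_cyclic_inertia_quotient shE_normal lin_i _ ik) DT ?idxT ?dat_card //.
exact: cyclic_shTE.
Qed.

Lemma cd_sheis : cd [set: gT] =i [:: 1%R; (q%:R)%R; (n%:R)%R; ((p ^ q * s)%:R)%R].
Proof.
have nz1 : ~~ (shZ \subset [1 gT]).
  apply/subsetPn; exists (el 0 0 1 0); first by rewrite mem_sh !eqxx dvdn0.
  by apply/set1P; rewrite el1 => /el_inj[_ _ /eqP]; rewrite oner_eq0.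
have nPZ : ~~ (shP \subset shZ).
  apply/subsetPn; exists (el 1 0 0 0); first by rewrite mem_sh dvdn0.
  by rewrite mem_sh oner_eq0.
have nG1 : ~~ ([set: gT]^`(1) \subset shP).
  apply: contra shK_notP; apply: subset_trans.
  by apply: subset_trans shK_sub_commg _; rewrite commSg ?subsetT.
have nsZ : shZ <| [set: gT].
  apply: normal_swap => g h; have [al [be [ze [k ->]]]] := elP g => Zh.
  have [b [z Dh]] := shE_el (subsetP shZ_subE h Zh).
  move: Zh; rewrite Dh mem_sh => /and4P[_ /eqP-> _ _]; rewrite conj_el.
  by eexists; last by []; rewrite mem_sh !phi0 !eqxx dvdn0.
have irr_cd (k : Iirr [set: gT]) : ('chi_k)%R 1%g \in cd [set: gT].
  by apply: map_f; rewrite mem_enum.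
move=> d; apply/idP/idP.
  case/mapP=> k _ ->; have [kerZ | nkerZ] := boolP (shZ \subset cfker ('chi_k)%R).
    have [kerP | nkerP] := boolP (shP \subset cfker ('chi_k)%R).
      by have := irr1_over_shP kerP; rewrite !inE => /orP[]->; rewrite ?orbT.
    by rewrite (irr1_over_shZ kerZ nkerP) !inE eqxx !orbT.
  by rewrite (irr1_not_over_shZ nkerZ) !inE eqxx !orbT.
rewrite !inE => /or4P[]/eqP->.
- by have := irr_cd 0%R; rewrite irr0 cfun11.
(* A character trivial on P but not on G' is nonlinear, which leaves only the degree q. *)
- have [k kerP nkerG1] := irr_cfker_separates shP_normal nG1.
  have := irr1_over_shP kerP; rewrite !inE => /orP[/eqP k1 | /eqP <- //].
  by rewrite -lin_irr_der1 qualifE /= irr_char k1 eqxx in nkerG1.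
- have [k kerZ nkerP] := irr_cfker_separates nsZ nPZ.
  by rewrite -(irr1_over_shZ kerZ nkerP).
have [k _ nkerZ] := irr_cfker_separates (normal1 [set: gT]) nz1.
by rewrite -(irr1_not_over_shZ nkerZ).
Qed.
End Structure.

(** * Arithmetic of the parameters *)

Section Arithmetic.
Set Implicit Arguments.
Unset Strict Implicit.
Unset Printing Implicit Defensive.
Import GroupScope GRing.Theory.

Lemma sum_expn_mod_pred p m : exists k, (\sum_(i < m) p.+1 ^ i = m + p * k)%N.
Proof.
elim: m => [|m [k IHm]]; first by exists 0; rewrite big_ord0 muln0.
exists (k + \sum_(i < m) p.+1 ^ i)%N; rewrite big_ord_recr /= IHm.
have -> : (p.+1 ^ m = 1 + p * \sum_(i < m) p.+1 ^ i)%N.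
  by rewrite -[in RHS](predn_exp p.+1) add1n prednK // expn_gt0.
by rewrite IHm; ring.
Qed.

(** Modulo q^2, (1 + q w)^i is 1 + i q w, so the sum is q + C(q, 2) q w, and q divides C(q, 2) as q
    is odd. Hence q divides (p^q - 1) / (p - 1) exactly once. *)
Lemma sum_expn_mod_sqr q w : prime q -> odd q ->
  exists k, (\sum_(i < q) (q * w).+1 ^ i = q * (q * k).+1)%N.
Proof.
move=> q_pr q_odd.
have expE i : exists e, ((q * w).+1 ^ i = 1 + i * (q * w) + q * q * e)%N.
  elim: i => [|i [e IHi]]; first by exists 0; rewrite mul0n muln0.
  exists (e * (q * w).+1 + i * w * w)%N; rewrite expnSr IHi; ring.
have sumE m : exists k, (\sum_(0 <= i < m) (q * w).+1 ^ i =
    m + (\sum_(0 <= i < m) i) * (q * w) + q * q * k)%N.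
  elim: m => [|m [k IHm]]; first by exists 0; rewrite !big_geq // muln0.
  have [e expm] := expE m; exists (k + e)%N.
  by rewrite !big_nat_recr //= IHm expm; ring.
have [k Dk] := sumE q.
have q_gt2 : 2 < q by apply: odd_prime_gt2.
have /dvdnP[v Dv] : q %| 'C(q, 2) by apply: prime_dvd_bin.
exists (v * w + k)%N.
by rewrite -(big_mkord xpredT (fun i => (q * w).+1 ^ i)%N) Dk bin2_sum Dv; ring.
Qed.

Lemma exists_prim_root (F : finFieldType) n :
  0 < n -> n %| #|F|.-1 -> exists c : F, (n.-primitive_root c)%R.
Proof.
move=> n_gt0 nF; set N := #|F|.-1.
have N_gt0 : 0 < N by rewrite -ltnS prednK ?finNzRing_gt1 // ltnW // finNzRing_gt1.
pose rs := enum (predC1 (0%R : F)).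
have : has (N.-primitive_root)%R rs.
  apply: has_prim_root => //; rewrite ?enum_uniq //.
    apply/allP=> x; rewrite mem_enum unity_rootE inE => nz; apply/eqP.
    apply: (mulfI nz); rewrite mulr1 -exprS prednK ?expf_card //.
    by rewrite ltnW // finNzRing_gt1.
  by rewrite -cardE cardC1.
by case/hasP=> c _ prim_c; exists (c ^+ (N %/ n))%R; apply: dvdn_prim_root.
Qed.

End Arithmetic.

Lemma semilinear_datum_exists (p q r : nat) :
  prime p -> prime q -> odd q -> q %| p.-1 -> r %| p.-1 -> coprime r q ->
  exists D : semilinear_datum,
    [/\ dat_p D = p, dat_q D = q, dat_A D = (((p ^ q).-1 %/ p.-1)`_(q^'))%N,
        dat_u D = ((p.-1)`_q)%N & dat_r D = r].
Proof.
move=> p_pr q_pr q_odd q_dvd r_dvd rq.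
set m := ((p ^ q).-1 %/ p.-1)%N; set A := (m`_(q^'))%N; set u := ((p.-1)`_q)%N.
have p_gt1 := prime_gt1 p_pr; have q_gt0 := prime_gt0 q_pr.
have p1_gt0 : (0 < p.-1)%N by rewrite -ltnS prednK // ltnW.
have mE : m = (\sum_(i < q) p ^ i)%N by rewrite /m predn_exp mulKn.
have pE : p = p.-1.+1 by rewrite prednK // ltnW.
have m_gt0 : (0 < m)%N.
  by rewrite mE -(prednK q_gt0) big_ord_recl.
have mp : (m * p.-1 = (p ^ q).-1)%N by rewrite mE predn_exp mulnC.
have Aq : (A * q = m)%N.
  have /dvdnP[w Dw] := q_dvd.
  have [k sumE] := sum_expn_mod_sqr w q_pr q_odd.
  have DmE : m = (q * (q * k).+1)%N by rewrite mE pE Dw mulnC -sumE.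
  have mq : (m`_q = q)%N.
    rewrite p_part DmE lognM // logn_prime // eqxx.
    rewrite logn_coprime ?addn0 ?expn1 //.
    exact: coprime_dvdl (dvdn_mulr k (dvdnn q)) (coprimenS _).
  by rewrite -[RHS](partnC q m_gt0) mq mulnC.
have [k mk] : exists k, (m = q + p.-1 * k)%N.
  by rewrite mE pE; apply: sum_expn_mod_pred.
have p_odd : odd p.
  by case/even_prime: p_pr q_dvd => // ->; rewrite dvdn1 => /eqP q1; rewrite q1 in q_pr.
have cAq : coprime A q.
  by apply: (@pnat_coprime q^'); rewrite ?part_pnat // pnatNK pnat_id.
(* A common divisor of A and p - 1 divides m = q + (p - 1) k, hence q, which is prime to A. *)
have cAp : coprime A p.-1.
  have gA : gcdn A p.-1 %| q.
    have : gcdn A p.-1 %| m by rewrite -Aq dvdn_mulr // dvdn_gcdl.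
    by rewrite mk dvdn_addl // dvdn_mulr // dvdn_gcdr.
  by rewrite /coprime -dvdn1 -(eqP cAq) dvdn_gcd dvdn_gcdl gA.
have q_dvd_u : q %| u.
  rewrite /u p_part -{1}[q]expn1 dvdn_exp2l // logn_gt0 mem_primes q_pr.
  by rewrite p1_gt0.
have crA : coprime A r := coprime_dvdr r_dvd cAp.
have cru : coprime u r by rewrite coprime_sym /u p_part coprimeXr.
have ur_dvd : u * r %| p.-1 by rewrite Gauss_dvd ?dvdn_part.
have A_gt1 : 1 < A.
  have le_pm : p <= m.
    rewrite mE -(subnKC (prime_gt1 q_pr)) !big_ord_recl /= expn1.
    by rewrite addnCA leq_addr.
  rewrite -(ltn_pmul2r q_gt0) Aq mul1n (leq_trans _ le_pm) //.
  by rewrite pE ltnS dvdn_leq.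
have u_odd : odd u.
  rewrite /u p_part oddX q_odd orbT //.
(* p - 1 is even, so m = A q has the parity of q. Oddness is needed for j + 1 = 2 to be prime to A q
   u. *)
have s_odd : odd (A * q * u).
  rewrite oddM u_odd andbT Aq mk oddD q_odd oddM.
  by rewrite -subn1 oddB ?p_odd // ltnW.
have r_gt0 : (0 < r)%N := dvdn_gt0 p1_gt0 r_dvd.
have csr : coprime (A * q * u) r.
  by rewrite !coprimeMl crA cru [coprime q r]coprime_sym rq.
have [F pF cardF] := pPrimePowerField p_pr q_gt0.
have s_gt0 : (0 < A * q * u)%N by rewrite !muln_gt0 q_gt0 (ltnW A_gt1) part_gt0.
have [c prim_c] : exists c : F, ((A * q * u * r).-primitive_root c)%R.
  apply: exists_prim_root; first by rewrite muln_gt0 s_gt0.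
  by rewrite cardF -mp -Aq -mulnA dvdn_pmul2l // muln_gt0 (ltnW A_gt1).
(* j is 1 modulo A q u and -1 modulo r: it is prime to both moduli, and r divides j + 1. *)
pose j := chinese (A * q * u) r 1 r.-1.
have js : j = 1 %[mod A * q * u] by apply: chinese_modl.
have jr : j = r.-1 %[mod r] by apply: chinese_modr.
have cjs : coprime j (A * q * u) by rewrite -coprime_modl js coprime_modl coprime1n.
have cjr : coprime j r.
  by rewrite -coprime_modl jr coprime_modl -{2}(prednK r_gt0) coprimenS.
have r_dvd_j1 : r %| j.+1.
  by rewrite /dvdn -addn1 -modnDml jr modnDml addn1 prednK ?modnn.
have cj1s : coprime j.+1 (A * q * u).
  rewrite -coprime_modl -addn1 -modnDml js modnDml coprime_modl.
  by rewrite coprime2n.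
have cjn : coprime j (A * q * u * r) by rewrite coprimeMr cjs.
by exists (@SemilinearDatum F c p q A u r j p_pr q_pr cardF prim_c q_dvd q_dvd_u
  A_gt1 cAp (etrans (congr1 (muln^~ _) Aq) mp) cjn r_dvd_j1 cj1s).
Qed.

Theorem theorem3p2 (p q r : nat) :
  prime p -> prime q -> odd q -> q %| p.-1 -> r %| p.-1 -> coprime r q ->
  exists (gT : finGroupType) (G : {group gT}),
    solvable G /\ derived_length_is G 4 /\ fitting_height_is G 3 /\
    let A := (((p ^ q).-1 %/ p.-1)`_(q^'))%N in
    cd G =i [:: 1%:R; q%:R; (A * (p.-1)`_q * q * r)%N%:R;
                (p ^ q * A * (p.-1)`_q * q)%N%:R]%R.
Proof.
move=> p_pr q_pr q_odd q_dvd r_dvd rq.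
have [D [pE qE AE uE rE]] := semilinear_datum_exists p_pr q_pr q_odd q_dvd r_dvd rq.
have dl4 := derived_length_sheis D; have fh3 := fitting_height_sheis D.
exists (sheis D), [set: sheis D]%G; split; last split=> //; last split=> //.
  by apply/derivedP; exists 4; have [-> _] := dl4.
move=> A d; rewrite cd_sheis /dat_n AE uE rE qE pE -/A.
by congr (_ \in [:: _; _; _%:R; _%:R])%R; ring.
Qed.
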